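(* Let $q=p^k$ with $p$ prime and $k\ge1$. Consider the dynamical systems $(\mathbb{F}_q, x\mapsto f(x))$ with $f(X)=aX^p+b$, where $a\in\mathbb{F}_q^*$ satisfies $\mathrm{Nm}_{\mathbb{F}_q/\mathbb{F}_p}(a)=1$ and $b\in\mathbb{F}_q$. Among these there are only two non-equivalent dynamical systems: two such systems are dynamically equivalent if and only if either both have a fixed point or neither has a fixed point. Moreover, if such an $f$ has a fixed point in $\mathbb{F}_q$, then it has precisely $p$ fixed points in $\mathbb{F}_q$.
   Context: Two dynamical systems $(\mathbb{S},f)$ and $(\mathbb{T},g)$ (maps $f:\mathbb{S}\to\mathbb{S}$, $g:\mathbb{T}\to\mathbb{T}$) are dynamically equivalent if there is a bijection $\sigma:\mathbb{S}\to\mathbb{T}$ with $\sigma^{-1}\circ g\circ\sigma=f$. A fixed point of $f$ is $x$ with $f(x)=x$. The norm is $\mathrm{Nm}_{\mathbb{F}_q/\mathbb{F}_p}(x)=x^{1+p+\cdots+p^{k-1}}$. *)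

(* Defs.v *)
From mathcomp Require Import all_boot all_order all_algebra all_field.

Set Implicit Arguments.
Unset Strict Implicit.
Unset Printing Implicit Defensive.

Import GRing.Theory.
Local Open Scope ring_scope.

(* [tau] is the inverse of the bijection [sigma]; equality of self-maps is
   taken pointwise. *)
Definition dyn_equiv (S T : Type) (f : S -> S) (g : T -> T) : Prop :=
  exists (sigma : S -> T) (tau : T -> S),
    [/\ cancel sigma tau, cancel tau sigma & tau \o g \o sigma =1 f].

Definition fixed_points (T : finType) (f : T -> T) : {set T} :=
  [set x | f x == x].

Definition has_fixed_point (T : Type) (f : T -> T) : Prop :=
  exists x, f x = x.

(* The norm from the field with p ^ k elements to its prime subfield, with
   values seen in the large field. *)
Definition Nm (p k : nat) (F : finFieldType) (x : F) : F :=
  x ^+ (\sum_(i < k) p ^ i)%N.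

Definition norm_one (p k : nat) (F : finFieldType) (a : F) : Prop :=
  a != 0 /\ Nm p k a = 1.

Definition frob_poly (p : nat) (F : finFieldType) (a b : F) : {poly F} :=
  a *: 'X^p + b%:P.

Definition frob_map (p : nat) (F : finFieldType) (a b : F) : F -> F :=
  fun x => (frob_poly p a b).[x].

(* Main.v *)
(** Affine substitutions conjugate each system to some [x |-> x ^+ p + b]:
    by Hilbert 90, [a * c ^+ p = c] for some nonzero [c].  Translating by [d]
    changes [b] by an element of the image [W] of [x |-> x ^+ p - x], and
    scaling by an element of the prime field [K] scales [b].  The system has a
    fixed point iff [b] lies in [W]; as [W] has index [p], the nonzero classes
    modulo [W] form one orbit under scaling by nonzero elements of [K].  The
    fixed points of [x |-> x ^+ p] are the [p] elements of [K]. *)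

Require Import Defs.
From mathcomp Require Import all_boot all_order all_algebra all_field.

Set Implicit Arguments.
Unset Strict Implicit.
Unset Printing Implicit Defensive.

Import GRing.Theory.
Local Open Scope ring_scope.

(** * Equivalence of systems and transport of fixed points *)

Lemma dyn_equiv_sym (S T : Type) (f : S -> S) (g : T -> T) :
  dyn_equiv f g -> dyn_equiv g f.
Proof.
move=> [s [t [sK tK E]]]; exists t, s; split=> // y /=.
by rewrite -E /= !tK.
Qed.

Lemma dyn_equiv_trans (S T U : Type) (f : S -> S) (g : T -> T) (h : U -> U) :
  dyn_equiv f g -> dyn_equiv g h -> dyn_equiv f h.
Proof.
move=> [s [t [sK tK E]]] [s' [t' [sK' tK' E']]].
exists (s' \o s), (t \o t'); split; try exact: can_comp.
by move=> x /=; rewrite -E /= -E'.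
Qed.

Lemma dyn_equiv_has_fixed_point (S T : Type) (f : S -> S) (g : T -> T) :
  dyn_equiv f g -> has_fixed_point f -> has_fixed_point g.
Proof.
move=> [s [t [sK tK E]]] [x fx]; exists (s x).
by apply: (can_inj tK); rewrite sK -[RHS]fx -E.
Qed.

Lemma dyn_equiv_card_fixed_points (S T : finType) (f : S -> S) (g : T -> T) :
  dyn_equiv f g -> #|fixed_points f| = #|fixed_points g|.
Proof.
move=> [s [t [sK tK E]]].
rewrite -(card_imset _ (can_inj sK)); apply: eq_card => y.
rewrite -[y]tK mem_imset ?inE; last exact: can_inj sK.
by rewrite -E /= tK -(inj_eq (can_inj tK)).
Qed.

(** * Counting by fibres and by roots *)

Lemma leq_card_fibers (S T : finType) (f : S -> T) (m : nat) :
  (forall y, #|[set x | f x == y]| <= m)%N -> (#|S| <= #|f @: S| * m)%N.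
Proof.
move=> fib; rewrite -[leqLHS]sum1_card.
rewrite (partition_big f (mem (f @: S))) => [|x _].
  rewrite -sum_nat_const; apply: leq_sum => y _.
  by rewrite sum1dep_card; apply: fib.
exact: imset_f.
Qed.

Lemma card_roots_leq (F : finFieldType) (P : {poly F}) :
  P != 0 -> (#|[set x | root P x]| < size P)%N.
Proof.
move=> P0; rewrite cardE; apply: max_poly_roots => //; last exact: enum_uniq.
by apply/allP => x; rewrite mem_enum inE.
Qed.

(** * Affine conjugation and Hilbert 90 *)

Section Frobenius.

Variables (p k : nat) (F : finFieldType).
Hypotheses (p_prime : prime p) (cardF : #|F| = (p ^ k)%N).
Implicit Types a b c d x y : F.

Let pF : p \in [pchar F].
Proof. exact: card_finPcharP cardF p_prime. Qed.

Let FrobB x y : (x - y) ^+ p = x ^+ p - y ^+ p.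
Proof. by rewrite -!(pFrobenius_autE pF) rmorphB. Qed.

Lemma frob_mapE a b x : frob_map p a b x = a * x ^+ p + b.
Proof. by rewrite /frob_map /frob_poly !hornerE. Qed.

(** The conjugating bijection is [x |-> c * x + d]. Since Frobenius is additive, intertwining the
    two systems amounts to comparing the coefficients of [x ^+ p] and the constant terms, which
    gives the two equations. *)
Lemma frob_map_affine a b a' b' c d : c != 0 ->
    c * a = a' * c ^+ p -> c * b + d = a' * d ^+ p + b' ->
  dyn_equiv (frob_map p a b) (frob_map p a' b').
Proof.
move=> c0 Ea Eb; exists (fun x => c * x + d), (fun y => c^-1 * (y - d)).
split=> x /=.
- by rewrite addrK mulKf.
- by rewrite mulVKf // subrK.
rewrite !frob_mapE; apply: (mulfI c0); rewrite mulVKf // mulrDr mulrA Ea.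
have -> : (c * x + d) ^+ p = c ^+ p * x ^+ p + d ^+ p.
  by rewrite -!(pFrobenius_autE pF) rmorphD rmorphM.
by rewrite mulrDr -!addrA -[c * b](addrK d) Eb !mulrA !addrA.
Qed.

(* The map [x |-> a * x ^+ p] has [k]-th iterate [Nm a * x ^+ q = x], so the
   sum of its first [k] iterates takes values among its fixed points, and this
   sum is a nonzero polynomial of degree less than [q]. *)
Lemma hilbert90_frob a : (0 < k)%N -> Nm p k a = 1 ->
  exists2 c, c != 0 & a * c ^+ p = c.
Proof.
move=> k0 Na.
(* With this exponent, [a ^+ e i * x ^+ (p ^ i)] is the [i]-th iterate of [x |-> a * x ^+ p]. *)
pose e i := (\sum_(j < i) p ^ j)%N.
pose P : {poly F} := \sum_(i < k) a ^+ e i *: 'X^(p ^ i).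
have p1 := prime_gt1 p_prime.
have P0 : P != 0.
  (* The coefficient of ['X] is 1: only the term [i = 0] contributes to it. *)
  apply/eqP => /(congr1 (fun Q : {poly F} => Q`_1)); rewrite coef0 coef_sum.
  case: k k0 => // k' _; rewrite big_ord_recl big1 => [|i _].
    rewrite coefZ coefXn expn0 eqxx mulr1 addr0 /e big_ord0 expr0.
    by move/eqP; rewrite oner_eq0.
  rewrite coefZ coefXn lift0 (ltn_eqF (_ : 1 < _)%N) ?mulr0 //.
  by rewrite -(exp1n i.+1) ltn_exp2r.
have sP : (size P <= #|F|)%N.
  rewrite cardF; apply: leq_trans (size_sum _ _ _) _.
  apply/bigmax_leqP => i _; apply: leq_trans (size_scale_leq _ _) _.
  by rewrite size_polyXn ltn_exp2l.
(* A nonzero polynomial of degree less than [q] cannot vanish on all of [F]. *)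
have /existsP[x Px] : [exists x, ~~ root P x].
  rewrite -negb_forall; apply/negP => /forallP H.
  have := card_roots_leq P0; rewrite ltnNge => /negP; apply.
  apply: leq_trans sP _; rewrite -cardsT subset_leq_card //.
  by apply/subsetP=> x; rewrite inE.
exists P.[x] => //.
have PE : P.[x] = \sum_(i < k) a ^+ e i * x ^+ (p ^ i).
  by rewrite horner_sum; apply: eq_bigr => i _; rewrite !hornerE.
pose t i := a ^+ e i * x ^+ (p ^ i).
have tS i : a * t i ^+ p = t i.+1.
  rewrite /t exprMn -!exprM mulrA -exprS -expnSr; congr (a ^+ _ * _).
  rewrite /e big_ord_recl expn0 big_distrl add1n /=; congr _.+1.
  by apply: eq_bigr => j _; rewrite -expnSr.
have tk : t k = t 0%N.
  by rewrite /t -cardF expf_card [a ^+ _]Na /e big_ord0.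
rewrite PE -(pFrobenius_autE pF) rmorph_sum mulr_sumr /=.
under eq_bigr => i _ do rewrite pFrobenius_autE tS.
(* Applying the map shifts the sum by one index. The old and the new sum both come from the sum over
   [k.+1] terms by dropping an end term, and the end terms agree because [t k = t 0]. *)
have : \sum_(i < k.+1) t i = \sum_(i < k) t i + t 0%N.
  by rewrite big_ord_recr /= tk.
by rewrite big_ord_recl addrC => /addIr.
Qed.

(** * The additive map [x |-> x ^+ p - x] *)

Lemma card_artin_schreier_fiber y : (#|[set x | (x ^+ p - x)%R == y]| <= p)%N.
Proof.
pose P : {poly F} := 'X^p - ('X + y%:P).
have sP : size P = p.+1.
  rewrite size_polyDl ?size_polyXn // size_polyN size_XaddC ltnS.
  exact: prime_gt1.
have := @card_roots_leq F P; rewrite -size_poly_eq0 sP ltnS => /(_ isT).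
apply: leq_trans; apply/subset_leq_card/subsetP => x; rewrite !inE.
by rewrite rootE !hornerE opprD addrA subr_eq0.
Qed.

(** The upper bound counts roots of ['X^p - 'X]; the lower bound comes from the images of
    [0, ..., p - 1], which are distinct in characteristic [p] and fixed by Frobenius. *)
Lemma card_frob_fixed : #|[set c : F | c ^+ p == c]| = p.
Proof.
apply/eqP; rewrite eqn_leq; apply/andP; split.
  apply: leq_trans (card_artin_schreier_fiber 0).
  by apply/eq_leq/eq_card => x; rewrite !inE subr_eq0.
have natr_inj : injective (fun i : 'I_p => (i : nat)%:R : F).
  suff H (i j : 'I_p) : (i <= j)%N -> i%:R = j%:R :> F -> i = j.
    move=> i j; case/orP: (leq_total i j) => ij Eij; first exact: H.
    by apply/esym/H.
  move=> ij /esym/eqP; rewrite -subr_eq0 -natrB // -(dvdn_pcharf pF) => pij.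
  apply: val_inj; apply/eqP; rewrite eqn_leq ij -subn_eq0 /=.
  apply: contraLR pij; rewrite -lt0n => /gtnNdvd-> //.
  exact: leq_ltn_trans (leq_subr _ _) (ltn_ord j).
rewrite -[leqLHS]card_ord -(card_imset _ natr_inj).
apply/subset_leq_card/subsetP => _ /imsetP[i _ ->].
by rewrite inE -(pFrobenius_autE pF) rmorph_nat.
Qed.

(** On a finite set a surjective self-map is injective, but here 0 and 1 both go to 0. *)
Lemma artin_schreier_not_surj : exists b, forall x, x ^+ p - x != b.
Proof.
suff /existsP[b /forallP bW] : [exists b : F, forall x, x ^+ p - x != b].
  by exists b.
apply: contraT; rewrite negb_exists => /forallP surj.
have : injective (fun x : F => x ^+ p - x).
  apply: in2T; apply/imset_injP; rewrite eqn_leq leq_imset_card /=.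
  apply/subset_leq_card/subsetP => y _.
  have := surj y; rewrite negb_forall => /existsP[x]; rewrite negbK => /eqP <-.
  exact: imset_f.
move/(_ 0 1); rewrite expr1n expr0n subr0 subrr gtn_eqF ?prime_gt0 //.
by move=> /(_ erefl)/eqP; rewrite eq_sym oner_eq0.
Qed.

(* The image [W] of [x |-> x ^+ p - x] has at least [q / p] elements and is
   stable under the prime field [K], so [K * b + W] has at least [q]. *)
Lemma artin_schreier_coset b b' : (forall x, x ^+ p - x != b) ->
  exists c d, c ^+ p = c /\ b' = c * b + (d ^+ p - d).
Proof.
move=> bW.
pose K := [set c : F | c ^+ p == c].
pose AS (x : F) := x ^+ p - x.
pose W := AS @: F.
have inj : {in setX K W &, injective (fun u => u.1 * b + u.2)}.
  move=> [c w] [c' w'] /setXP[/= cK /imsetP[x _ ->]].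
  move=> /setXP[/= c'K /imsetP[x' _ ->]] E.
  have [Ec|nc] := eqVneq c c'; first by move: E; rewrite Ec => /addrI ->.
  have c0 : c - c' != 0 by rewrite subr_eq0.
  have EE : (c - c') * b = AS (x' - x).
    have -> : AS (x' - x) = AS x' - AS x by rewrite /AS FrobB !opprD addrACA.
    apply/eqP; rewrite mulrBl subr_eq addrAC eq_sym subr_eq.
    by rewrite [X in X == _]addrC E.
  (* If [c] and [c'] differ, dividing by [c - c'], which Frobenius fixes, exhibits [b] as an element
     of [W]. *)
  have /negP[] := bW ((x' - x) / (c - c')).
  move: cK c'K; rewrite !inE => /eqP cK /eqP c'K.
  rewrite exprMn exprVn (FrobB c) cK c'K -mulrBl.
  by rewrite -[_ - (x' - x)]EE mulrC mulKf.
have full : (fun u => u.1 * b + u.2) @: setX K W = setT.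
  (* Fibres of [AS] have at most [p] elements, so [q <= #|W| * p], and [p] is the size of [K]. *)
  apply/eqP; rewrite eqEcard subsetT cardsT (card_in_imset inj) cardsX.
  rewrite card_frob_fixed mulnC; apply: leq_card_fibers.
  exact: card_artin_schreier_fiber.
have : b' \in [set: F] by rewrite inE.
rewrite -full => /imsetP[[c w] /setXP[/= + /imsetP[d _ ->]] ->].
by rewrite inE => /eqP cK; exists c, d.
Qed.

(** * Normal forms and classification *)

Lemma frob_map_normal a b : (0 < k)%N -> norm_one p k a ->
  exists b', dyn_equiv (frob_map p a b) (frob_map p 1 b').
Proof.
move=> k0 [_ Na]; have [c c0 Ec] := hilbert90_frob k0 Na.
(* Scaling by [c^-1] turns the leading coefficient into 1 exactly because [a * c ^+ p = c]. *)
exists (c^-1 * b); apply: (@frob_map_affine _ _ _ _ c^-1 0).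
- by rewrite invr_eq0.
- apply: (mulfI c0); rewrite mulVKf // mul1r exprVn -{1}Ec.
  apply: (mulIf (expf_neq0 p c0)).
  by rewrite Ec mulfVK // expf_neq0.
by rewrite expr0n gtn_eqF ?prime_gt0 // mulr0 addr0 add0r.
Qed.

(** A fixed point [x] corresponds to the solution [- x]. The sign is moved through the power by
    additivity of Frobenius, so [p = 2] needs no separate case. *)
Lemma has_fixed_point_frob1 b :
  has_fixed_point (frob_map p 1 b) <-> exists x, x ^+ p - x = b.
Proof.
have E x : (frob_map p 1 b x = x) <-> ((- x) ^+ p - (- x) = b).
  rewrite -sub0r FrobB expr0n gtn_eqF ?prime_gt0 //.
  rewrite frob_mapE mul1r !sub0r opprK addrC.
  rewrite [- _ + x]addrC; split=> [Ex|<-]; last by rewrite subrK.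
  by rewrite -{1}Ex addrK.
split=> [[x /E Ex]|[x Ex]]; first by exists (- x).
by exists (- x); apply/E; rewrite opprK.
Qed.

Lemma frob1_equiv_fixed b : has_fixed_point (frob_map p 1 b) ->
  dyn_equiv (frob_map p 1 b) (frob_map p (1 : F) 0).
Proof.
case/has_fixed_point_frob1=> d <-.
apply: (@frob_map_affine _ _ _ _ 1 d); rewrite ?oner_neq0 ?expr1n //.
by rewrite !mul1r subrK addr0.
Qed.

Lemma frob1_equiv_no_fixed b b' : ~ has_fixed_point (frob_map p 1 b) ->
    ~ has_fixed_point (frob_map p 1 b') ->
  dyn_equiv (frob_map p 1 b) (frob_map p 1 b').
Proof.
move=> nb nb'.
have bW x : x ^+ p - x != b.
  by apply/eqP => Ex; apply: nb; apply/has_fixed_point_frob1; exists x.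
have [c [d [cK Eb']]] := artin_schreier_coset b' bW.
apply: (@frob_map_affine _ _ _ _ c (- d)).
(* The scalar is nonzero, since otherwise [b' = d ^+ p - d] and the second system would have a fixed
   point. *)
- apply/eqP => c0; apply: nb'; apply/has_fixed_point_frob1; exists d.
  by rewrite Eb' c0 mul0r add0r.
- by rewrite cK mulr1 mul1r.
rewrite mul1r -sub0r FrobB expr0n gtn_eqF ?prime_gt0 // !sub0r Eb'.
by rewrite addrCA addKr.
Qed.

Lemma frob_map_equivP a b a' b' : (0 < k)%N ->
    norm_one p k a -> norm_one p k a' ->
  dyn_equiv (frob_map p a b) (frob_map p a' b') <->
  (has_fixed_point (frob_map p a b) /\ has_fixed_point (frob_map p a' b')) \/
  (~ has_fixed_point (frob_map p a b) /\ ~ has_fixed_point (frob_map p a' b')).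
Proof.
move=> k0 /(frob_map_normal b k0)[c eqc] /(frob_map_normal b' k0)[c' eqc'].
have fixc := dyn_equiv_has_fixed_point eqc.
have fixc' := dyn_equiv_has_fixed_point eqc'.
have fixcV := dyn_equiv_has_fixed_point (dyn_equiv_sym eqc).
have fixcV' := dyn_equiv_has_fixed_point (dyn_equiv_sym eqc').
split=> [E|H].
  have fixE := dyn_equiv_has_fixed_point E.
  have fixEV := dyn_equiv_has_fixed_point (dyn_equiv_sym E).
  (* As [F] is finite, having a fixed point is decidable. *)
  have [|nofix] := boolP [exists x, frob_map p a b x == x].
    by case/existsP=> x /eqP Ex; left; split; [|apply: fixE]; exists x.
  have nb : ~ has_fixed_point (frob_map p a b).
    by case=> x Ex; case/existsP: nofix; exists x; apply/eqP.
  by right; split=> // /fixEV.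
apply: dyn_equiv_trans eqc (dyn_equiv_trans _ (dyn_equiv_sym eqc')).
case: H => [[fb fb']|[nb nb']].
  apply: dyn_equiv_trans (frob1_equiv_fixed (fixc fb)) _.
  exact/dyn_equiv_sym/frob1_equiv_fixed/fixc'.
by apply: frob1_equiv_no_fixed; [move/fixcV|move/fixcV'].
Qed.

Lemma card_fixed_points_frob a b : (0 < k)%N -> norm_one p k a ->
  has_fixed_point (frob_map p a b) -> #|fixed_points (frob_map p a b)| = p.
Proof.
move=> k0 Na fixb; have [c eqc] := frob_map_normal b k0 Na.
have fixc := dyn_equiv_has_fixed_point eqc fixb.
have eq0 := dyn_equiv_trans eqc (frob1_equiv_fixed fixc).
rewrite (dyn_equiv_card_fixed_points eq0).
rewrite -[RHS]card_frob_fixed; apply: eq_card => x.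
by rewrite !inE frob_mapE mul1r addr0.
Qed.

End Frobenius.

Theorem theorem3p6 (p k : nat) (F : finFieldType)
    (p_prime : prime p) (k_ge1 : (1 <= k)%N) (cardF : #|F| = (p ^ k)%N) :
  [/\ (exists a0 b0 a1 b1 : F,
        [/\ norm_one p k a0, norm_one p k a1,
            ~ dyn_equiv (frob_map p a0 b0) (frob_map p a1 b1) &
            forall a b : F, norm_one p k a ->
              dyn_equiv (frob_map p a b) (frob_map p a0 b0) \/
              dyn_equiv (frob_map p a b) (frob_map p a1 b1)]),
      (forall a b a' b' : F, norm_one p k a -> norm_one p k a' ->
        (dyn_equiv (frob_map p a b) (frob_map p a' b') <->
         (has_fixed_point (frob_map p a b) /\
          has_fixed_point (frob_map p a' b')) \/
         (~ has_fixed_point (frob_map p a b) /\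
          ~ has_fixed_point (frob_map p a' b')))) &
      (forall a b : F, norm_one p k a ->
        has_fixed_point (frob_map p a b) ->
        #|fixed_points (frob_map p a b)| = p)].
Proof.
split; last 1 first.
- by move=> a b; apply: (card_fixed_points_frob p_prime cardF).
- have N1 : norm_one p k (1 : F) by split; rewrite ?oner_neq0 // /Nm expr1n.
  (* The two representatives are [x ^+ p], which fixes 1, and [x ^+ p + b1] with [b1] outside the
     image of [x |-> x ^+ p - x]. *)
  have [b1 b1W] := artin_schreier_not_surj F p_prime.
  have fix0 : has_fixed_point (frob_map p (1 : F) 0).
    by exists 1; rewrite frob_mapE expr1n mulr1 addr0.
  have nofix1 : ~ has_fixed_point (frob_map p 1 b1).
    by case/(has_fixed_point_frob1 p_prime cardF)=> x /eqP; apply/negP.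
  exists 1, 0, 1, b1; split=> // [/dyn_equiv_has_fixed_point/(_ fix0)//|a b Na].
  have [|nofix] := boolP [exists x, frob_map p a b x == x].
    case/existsP=> x /eqP Ex; left; apply/(frob_map_equivP p_prime cardF) => //.
    by left; split=> //; exists x.
  right; apply/(frob_map_equivP p_prime cardF) => //; right; split=> //.
  by case=> x Ex; case/existsP: nofix; exists x; apply/eqP.
by move=> a b a' b'; apply: (frob_map_equivP p_prime cardF).
Qed.
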